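(* Fix a prime power $q$. Let $\{P_i\}_i$ be an infinite family of toric codes over $\mathbb{F}_q$ such that the sequence $\{M(P_i)\}_i$ is bounded. Then $R(P_i)\to 0$ as $i\to\infty$. Consequently, there is no good infinite family of toric codes, i.e. there is no infinite family of toric codes $\{P_i\}_i$ for which both $\lim_i d(P_i)$ and $\lim_i R(P_i)$ are positive.
   Context: Let $q$ be a prime power. For a nonempty integral convex polytope $P\subseteq[0,q-2]^n\subseteq\mathbb{R}^n$, the toric code $C_P$ is the image of the injective $\mathbb{F}_q$-linear map from the $\mathbb{F}_q$-span of the monomials $x^m$, $m\in P\cap\mathbb{Z}^n$, to $\mathbb{F}_q^{(q-1)^n}$ sending a polynomial $g$ to its vector of values $(g(t))_{t\in(\mathbb{F}_q^* )^n}$. The minimum distance of $C_P$ is the minimum Hamming weight of a nonzero vector of $C_P$. Define the relative minimum distance $d(P)=(\text{minimum distance of }C_P)/(q-1)^n$ and the information rate $R(P)=|P\cap\mathbb{Z}^n|/(q-1)^n$. An infinite family of toric codes is a sequence $\{P_i\}_i$ of nonempty integral convex polytopes with $P_i\subseteq[0,q-2]^{n_i}\subseteq\mathbb{R}^{n_i}$, such that $n_i\to\infty$ and both sequences $\{d(P_i)\}_i$ and $\{R(P_i)\}_i$ converge. For an integral convex polytope $P\subseteq\mathbb{R}^n$, $M(P)$ is the largest integer $m$ such that there is a unimodular affine transformation $A$ (an affine map $x\mapsto Bx+z$ with $B$ an injective integer $n\times m$ matrix and $z\in\mathbb{Z}^n$) with $A([0,1]^m)\subseteq P$.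
   Formalization: The formal theorem assumes q > 2; for q = 2 the box [0,q-2]^n is {0}, so every P_i = {0} has M(P_i) = 0 and d(P_i) = R(P_i) = 1, and both claims fail. *)

(* Defs.v *)
From HB Require Import structures.
From mathcomp Require Import all_boot all_order all_algebra.
From mathcomp Require Import finmap.
From mathcomp Require Import all_classical all_reals all_analysis.
(* The notations of mpoly clash with those of mathcomp-analysis. *)
From mathcomp Require Import -(notations) mpoly.

Set Implicit Arguments.
Unset Strict Implicit.
Unset Printing Implicit Defensive.

Import Order.TTheory GRing.Theory Num.Theory.
Import numFieldNormedType.Exports.

Local Open Scope classical_set_scope.
Local Open Scope ring_scope.

(* Points of R^n are column vectors. *)

Section Polytopes.
Variables (R : realType) (n : nat).
Implicit Types (S P : set 'cV[R]_n) (m : nat).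

Definition int_point (z : 'cV[int]_n) : 'cV[R]_n := map_mx intr z.

Definition convex_hull S : set 'cV[R]_n :=
  smallest (@convex_set R 'cV[R]_n) S.

Definition integral_polytope P : Prop :=
  exists V : seq 'cV[int]_n, P = convex_hull [set int_point v | v in [set` V]].

Definition lattice_points P : set 'cV[int]_n := [set z | P (int_point z)].

Definition unit_cube m : set 'cV[R]_m := [set x | forall i, 0 <= x i 0 <= 1].

Definition contains_cube P m : Prop :=
  exists (B : 'M[int]_(n, m)) (z : 'cV[int]_n),
    let B' : 'M[R]_(n, m) := map_mx intr B in
    injective (fun x : 'cV[R]_m => B' *m x) /\
    [set B' *m x + int_point z | x in @unit_cube m] `<=` P.

(* Injectivity of B bounds m by n. *)
Lemma contains_cube_leq P m : contains_cube P m -> (m <= n)%N.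
Proof.
move=> [B [z [/= injB _]]]; set B' := map_mx intr B in injB.
suff /eqP <- : row_free B'^T by rewrite rank_leq_col.
rewrite -kermx_eq0; apply/eqP/row_matrixP => i; rewrite row0.
apply: trmx_inj; rewrite trmx0; apply: injB; rewrite mulmx0.
by apply: trmx_inj; rewrite trmx_mul trmxK -row_mul mulmx_ker row0 trmx0.
Qed.

Definition max_cube P : nat := \max_(m < n.+1 | `[< contains_cube P m >]) m.

Lemma max_cubeP P : P !=set0 -> integral_polytope P ->
  contains_cube P (max_cube P) /\
  (forall m, contains_cube P m -> (m <= max_cube P)%N).
Proof.
move=> [p Pp] [V PV].
have cube0 : contains_cube P 0.
  have [v vV] : exists v, v \in V.
    case: V PV => [|v V _]; last by exists v; rewrite mem_head.
    move=> PV; move: Pp; rewrite PV => hull0; suff : set0 p by [].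
    by apply: hull0; split=> [x y l|x [v //]]; rewrite inE.
  exists 0, v; split=> [x y _|x [y _ <-]]; first by rewrite !flatmx0.
  rewrite flatmx0 mulmx0 add0r PV => A [_]; apply; exists v => //.
split=> [|m Pm].
  rewrite /max_cube.
  pose A := [pred k : 'I_n.+1 | `[< contains_cube P k >]].
  have A0 : (0 < #|A|)%N by apply/card_gt0P; exists ord0; exact/asboolP.
  have [i iA E] := eq_bigmax_cond (@nat_of_ord n.+1) A0.
  have -> : \max_(k < n.+1 | `[< contains_cube P k >]) k = i by exact: E.
  exact/asboolP.
have mn : (m < n.+1)%N by rewrite ltnS (contains_cube_leq Pm).
by apply: (@leq_bigmax_cond _ _ (@nat_of_ord n.+1) (Ordinal mn)); apply/asboolP.
Qed.

End Polytopes.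

Section ToricCodes.
Variables (R : realType) (F : finFieldType) (n : nat).
Implicit Types (P : set 'cV[R]_n).

(* (F^* )^n *)
Definition torus : Type := {ffun 'I_n -> {unit F}}.
HB.instance Definition _ := Finite.on torus.

Definition word : Type := {ffun torus -> F}.
HB.instance Definition _ := Finite.on word.
HB.instance Definition _ := GRing.Zmodule.on word.

Definition evaluation (g : mpoly n F) : word :=
  [ffun t : torus => meval (fun i => FinRing.uval (t i)) g].

Definition monomial_span P : set (mpoly n F) :=
  [set g | forall m : multinom n,
     m \in msupp g -> P (\col_i (m i)%:R)].

Definition toric_code P : set word := [set evaluation g | g in monomial_span P].

Definition hamming_weight (c : word) : nat := #|[set t | c t != 0]%SET|.

(* The block length #|torus| bounds every weight, so using it as the default
   value does not change the minimum when C has a nonzero word. *)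
Definition minimum_distance (C : set word) : nat :=
  \big[minn / #|{: torus}|]_(c : word | (c \in C) && (c != 0)) hamming_weight c.

Definition box : set 'cV[R]_n :=
  [set x | forall i, 0 <= x i 0 <= #|F|%:R - 2].

Definition relative_distance P : R :=
  (minimum_distance (toric_code P))%:R / (#|F|%:R - 1) ^+ n.

(* fset_set is meaningful on finite sets; lattice_points P is finite as soon as
   P is bounded, in particular if P is contained in the box. *)
Definition information_rate P : R :=
  (#|` fset_set (lattice_points P)|)%:R / (#|F|%:R - 1) ^+ n.

End ToricCodes.

Definition infinite_toric_family (R : realType) (F : finFieldType)
    (n : nat -> nat) (P : forall i, set 'cV[R]_(n i)) : Prop :=
  [/\ forall i, [/\ integral_polytope (P i), P i !=set0
                  & P i `<=` @box R F (n i)],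
      n @ \oo --> \oo,
      cvgn (fun i => relative_distance F (P i))
    & cvgn (fun i => information_rate F (P i))].

(* Main.v *)
(* Put q = #|F| and k = q - 1.

   If a positive proportion of [0, k-1]^n lies in a convex set P and n is large,
   split off L coordinates: most points share their last n - L coordinates with
   another one, so for some pair x <> x' the slices of P over x and x' have a
   common part of positive density. By induction this part contains an m-cube,
   and its product with the segment [x, x'] is an (m+1)-cube in P, by convexity.
   Hence a bound on M(P) forces the information rate to 0.

   Conversely, let P contain the cube z + B [0,1]^m, and for a in (F^* )^m consider
   g_a = x^z \prod_j (x^(B_j) - a_j). Its monomials are distinct and lie in the
   box, so g_a has a nonzero codeword, although B need not be injective modulo k.
   A fixed t is a non-zero of exactly (k-1)^m of the k^m polynomials g_a, so some
   g_a has relative weight at most ((k-1)/k)^m. Hence a positive limit of the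
   relative distances bounds M(P). *)

Require Import Defs.
From HB Require Import structures.
From mathcomp Require Import all_boot all_order all_algebra.
From mathcomp Require Import all_fingroup all_solvable.
From mathcomp Require Import zify lra.
From mathcomp Require Import finmap.
From mathcomp Require Import all_classical all_reals all_analysis.
From mathcomp Require Import -(notations) mpoly.
Import Order.TTheory GRing.Theory Num.Theory.
Import numFieldNormedType.Exports.
Local Open Scope classical_set_scope.
Local Open Scope ring_scope.

Set Implicit Arguments.
Unset Strict Implicit.
Unset Printing Implicit Defensive.

Lemma card_sum_mem (T : finType) (A : {pred T}) : #|A| = (\sum_x (x \in A))%N.
Proof.
by rewrite -sum1_card big_mkcond; apply: eq_bigr => x _; case: (x \in A).
Qed.

(** * Convexity, slices and cubes *)

Lemma convex_setP (R : realType) (n : nat) (P : set 'cV[R]_n) :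
  convex_set P <->
  forall (l : R) x y, 0 <= l <= 1 -> P x -> P y -> P (l *: x + (1 - l) *: y).
Proof.
split=> [cP l x y /andP[l0 l1] Px Py|cP x y l].
  by have := cP x y (Itv01 l0 l1); rewrite !inE; exact.
rewrite !inE; apply: cP.
by apply/andP; split; [exact: ge0|exact: le1].
Qed.

Lemma convex_integral_polytope (R : realType) (n : nat) (P : set 'cV[R]_n) :
  integral_polytope P -> convex_set P.
Proof.
move=> [V ->]; apply/convex_setP => l x y l01 hx hy A [cA VA].
by move/convex_setP: (cA); apply => //; [exact: hx|exact: hy].
Qed.

Definition slice (R : realType) (L n : nat) (P : set 'cV[R]_(L + n))
    (x : 'cV[int]_L) : set 'cV[R]_n :=
  [set y | P (col_mx (int_point R x) y)].

Lemma convex_slice (R : realType) (L n : nat) (P : set 'cV[R]_(L + n)) x :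
  convex_set P -> convex_set (slice P x).
Proof.
move=> /convex_setP cP; apply/convex_setP => l y z l01 Py Pz.
rewrite /slice /=.
rewrite (_ : col_mx _ _ = l *: col_mx (int_point R x) y
                          + (1 - l) *: col_mx (int_point R x) z).
  exact: cP.
by rewrite !scale_col_mx add_col_mx -scalerDl subrKC scale1r.
Qed.

Lemma contains_cube_slices (R : realType) (L n m : nat)
    (P : set 'cV[R]_(L + n)) (x y : 'cV[int]_L) :
  convex_set P -> x != y ->
  contains_cube (slice P x `&` slice P y) m -> contains_cube P (1 + m).
Proof.
move=> /convex_setP cP xy [B [z [/= injB sub]]].
(* The first cube coordinate runs along the segment from [x] to [y], the others along the given
   cube; injectivity in the first one is [x != y]. *)
exists (block_mx (y - x) 0 0 B), (col_mx x z).
have E (t : 'cV[R]_1) (s : 'cV[R]_m) :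
    map_mx intr (block_mx (y - x) 0 0 B) *m col_mx t s
    = col_mx (t 0 0 *: (int_point R y - int_point R x)) (map_mx intr B *m s).
  rewrite map_block_mx !map_mx0 mul_block_col !mul0mx addr0 add0r.
  congr col_mx; rewrite map_mxB.
  by apply/matrixP => i j; rewrite !mxE big_ord1 !mxE (ord1 j) mulrC.
split=> [u v|u [w w01 <-]].
  rewrite -[u]vsubmxK -[v]vsubmxK !E => /eq_col_mx[Et /injB ->].
  congr col_mx; apply/matrixP => i j; rewrite !ord1.
  apply/eqP; rewrite -subr_eq0.
  have /eqP : (usubmx u 0 0 - usubmx v 0 0) *: (int_point R y - int_point R x) = 0.
    by rewrite scalerBl Et subrr.
  rewrite scaler_eq0 => /orP[//|/eqP/subr0_eq yx].
  case/negP: xy; apply/eqP/matrixP => a b.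
  move/matrixP/(_ a b): yx; by rewrite !mxE => /intr_inj.
rewrite -[w]vsubmxK E; set t := usubmx w; set s := dsubmx w.
have t01 : 0 <= t 0 0 <= 1 by rewrite mxE.
have /sub[Px Py] : [set map_mx intr B *m v + int_point R z | v in @unit_cube R m]
  (map_mx intr B *m s + int_point R z).
  by exists s => // i; rewrite mxE.
(* Convex combination of two points of [P] with the same last [n] coordinates, one over [y] and one
   over [x]. *)
rewrite (_ : _ + _ = t 0 0 *: col_mx (int_point R y) (map_mx intr B *m s + int_point R z)
   + (1 - t 0 0) *: col_mx (int_point R x) (map_mx intr B *m s + int_point R z)).
  exact: cP.
rewrite [int_point R (col_mx _ _)]map_col_mx !scale_col_mx !add_col_mx; congr col_mx.
  by rewrite scalerBr scalerBl scale1r -addrA [- _ + _]addrC.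
by rewrite -scalerDl subrKC scale1r.
Qed.

(** * Counting grid points of convex sets without large cubes *)

Definition grid_point (k n : nat) (a : 'cV['I_k]_n) : 'cV[int]_n :=
  map_mx (fun i : 'I_k => Posz i) a.

Lemma grid_point_inj (k n : nat) : injective (@grid_point k n).
Proof.
move=> a b ab; apply/matrixP => i j.
by move/matrixP/(_ i j): ab; rewrite !mxE => -[] /val_inj.
Qed.

Definition grid_points (R : realType) (k n : nat) (P : set 'cV[R]_n) :
    {set 'cV['I_k]_n} :=
  [set a | `[< P (int_point R (grid_point a)) >]]%SET.

Lemma grid_points_col (R : realType) (k L n : nat) (P : set 'cV[R]_(L + n))
    (a : 'cV['I_k]_L) (b : 'cV['I_k]_n) :
  (col_mx a b \in grid_points k P) = (b \in grid_points k (slice P (grid_point a))).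
Proof. by rewrite !inE /grid_point /int_point /slice /= !map_col_mx. Qed.

Lemma grid_points_setI (R : realType) (k n : nat) (P Q : set 'cV[R]_n) :
  grid_points k (P `&` Q) = (grid_points k P :&: grid_points k Q)%SET.
Proof.
apply/setP => a; rewrite !inE; apply/asboolP/andP => [[Pa Qa]|[]].
  by split; apply/asboolP.
by move=> /asboolP Pa /asboolP Qa.
Qed.

(* A fiber of size f has at least f - 1 ordered pairs of distinct points. *)
Lemma card_grid_points_pairs (R : realType) (k L n : nat) (P : set 'cV[R]_(L + n)) :
  (#|grid_points k P| <= k ^ n +
     \sum_(p : 'cV['I_k]_L * 'cV['I_k]_L | p.1 != p.2)
        #|grid_points k (slice P (grid_point p.1) `&` slice P (grid_point p.2))|)%N.
Proof.
pose Q (a : 'cV['I_k]_L) := slice P (grid_point a).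
have -> : #|grid_points k P| = (\sum_b \sum_a (b \in grid_points k (Q a)))%N.
  rewrite exchange_big pair_big /= card_sum_mem (reindex (fun p => col_mx p.1 p.2)) /=.
    by apply: eq_bigr => -[a b] _; rewrite grid_points_col.
  exists (fun c => (usubmx c, dsubmx c)) => [[a b] _|c _] /=.
    by rewrite col_mxKu col_mxKd.
  by rewrite vsubmxK.
have -> : (k ^ n = \sum_(b : 'cV['I_k]_n) 1)%N.
  by rewrite sum1_card card_mx card_ord muln1.
under [X in (_ <= _ + X)%N]eq_bigr => p _ do rewrite card_sum_mem.
rewrite [X in (_ <= _ + X)%N]exchange_big -big_split /=; apply: leq_sum => b _.
set A := [set a | b \in grid_points k (Q a)]%SET.
have inA a : (a \in A) = (b \in grid_points k (Q a)) by rewrite [LHS]inE.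
under eq_bigr do rewrite -inA.
rewrite -card_sum_mem.
have [->|[a0 a0A]] := set_0Vmem A; first by rewrite cards0.
rewrite (cardsD1 a0) a0A leq_add2l.
rewrite card_sum_mem [leqRHS]big_mkcond /=.
(* Keeping only the pairs with first component [a0] already gives [#|A| - 1]. *)
rewrite -(pair_bigA _ (fun i j => if i != j then
   nat_of_bool (b \in grid_points k (Q i `&` Q j)) else 0%N)) /=.
rewrite [leqRHS](bigD1 a0) //=; apply: leq_trans (leq_addr _ _).
apply: leq_sum => a _; rewrite in_setD1 grid_points_setI finset.in_setI.
by rewrite -!inA a0A eq_sym; case: eqP.
Qed.

(* The box argument of Kovari-Sos-Turan and Erdos: if many fibers over the first
   L coordinates contain two points, then some pair of points lies in a positive
   proportion of the fibers, and one recurses in the common fiber. *)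
Lemma sparse_grid_points (R : realType) (k m c : nat) : (1 < k)%N ->
  exists N, forall n (P : set 'cV[R]_n), (N <= n)%N -> convex_set P ->
    ~ contains_cube P m -> (c * #|grid_points k P| <= k ^ n)%N.
Proof.
move=> k1; elim: m c => [|m IH] c.
  exists 0 => n P _ _ noc.
  suff -> : grid_points k P = finset.set0 by rewrite cards0 muln0.
  apply/setP => a; rewrite !inE; apply/negP => /asboolP Pa; apply: noc.
  exists 0, (grid_point a); split=> [x y _|x [y _ <-]].
    by rewrite !flatmx0.
  by rewrite flatmx0 mulmx0 add0r.
(* With this [L] the error term of the pair bound uses up at most half of the allowed count. *)
pose L := (2 * c)%N; have cL : (2 * c <= k ^ L)%N by exact/ltnW/ltn_expl.
(* There are at most [k ^ L * k ^ L] pairs of slices; with this density for each, all of them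
   together fill at most the other half. *)
have [N IHN] := IH (2 * c * k ^ L)%N.
exists (L + N)%N => n P Nn.
have [j jE] : exists j, n = (L + j)%N.
  by exists (n - L)%N; rewrite subnKC // (leq_trans (leq_addr _ _) Nn).
rewrite {}jE leq_add2l in P Nn *.
move=> cP noc.
have kL0 : (0 < k ^ L)%N by rewrite expn_gt0 ltnW.
rewrite -(leq_pmul2l (isT : 0 < 2)%N) mulnA.
apply: leq_trans (leq_mul (leqnn _) (card_grid_points_pairs k P)) _.
rewrite mulnDr [leqRHS]mul2n -addnn; apply: leq_add.
  by rewrite expnD leq_mul2r cL orbT.
rewrite -(leq_pmul2l kL0) mulnA [(k ^ L * _)%N]mulnC big_distrr /=.
apply: (@leq_trans (\sum_(p : 'cV['I_k]_L * 'cV['I_k]_L) k ^ j)); last first.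
  by rewrite sum_nat_const card_prod !card_mx !card_ord muln1 expnD mulnA.
rewrite big_mkcond /=; apply: leq_sum => -[a b] _ /=; case: ifP => // ab.
apply: IHN => //.
  apply/convex_setP => l x y l01 [xa xb] [ya yb].
  split; [move: xa ya|move: xb yb]; move: l01;
    move/convex_slice/convex_setP: cP; exact.
move=> /contains_cube_slices cc; apply: noc; apply: cc => //.
by rewrite (inj_eq (@grid_point_inj k L)) ab.
Qed.

(** * Character sums and injectivity of evaluation *)

Lemma sum_unit_expn (F : finFieldType) (j : nat) : ~~ (#|F|.-1 %| j)%N ->
  \sum_(u : {unit F}) FinRing.uval u ^+ j = 0.
Proof.
have /cyclicP[x genx] := field_unit_group_cyclic [set: {unit F}]%G.
rewrite -card_finField_unit genx order_dvdn => xj.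
have {xj} xj : FinRing.uval x ^+ j != 1.
  apply: contra xj => /eqP xj; apply/eqP/val_inj.
  by rewrite /= FinRing.val_unitX.
set S := \sum_u _.
(* Substituting [x * u] for [u], with [x] a generator, multiplies the sum by [x ^+ j], which is not
   1. *)
have : (FinRing.uval x ^+ j - 1) * S = 0.
  rewrite mulrBl mul1r {2}/S (reindex_inj (mulgI x)) mulr_sumr -sumrB.
  by apply: big1 => u _; rewrite FinRing.val_unitM exprMn subrr.
by move/eqP; rewrite mulf_eq0 subr_eq0 (negPf xj) => /eqP.
Qed.

(** Translation by 1 permutes [F], so the sum of all elements absorbs [#|F|] copies of 1. *)
Lemma natr_card_finField (F : finFieldType) : #|F|%:R = 0 :> F.
Proof.
have : \sum_(x : F) (x + 1) = \sum_(x : F) x by rewrite [RHS](reindex_inj (addIr 1)).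
rewrite big_split /= sumr_const => /eqP.
by rewrite -subr_eq0 addrAC subrr add0r => /eqP.
Qed.

Lemma card_unit (F : finFieldType) : #|{: {unit F}}| = #|F|.-1.
Proof. by rewrite -card_finField_unit cardsT. Qed.

Lemma natr_card_unit (F : finFieldType) : #|{: {unit F}}|%:R != 0 :> F.
Proof.
rewrite card_unit -subn1 natrB; last by apply/card_gt0P; exists 0.
by rewrite natr_card_finField sub0r oppr_eq0 oner_eq0.
Qed.

Lemma card_torus (F : finFieldType) (n : nat) : #|{: torus F n}| = (#|F|.-1 ^ n)%N.
Proof. by rewrite card_ffun card_unit card_ord. Qed.

Lemma sum_torus_monomial (F : finFieldType) (n : nat) (e : 'I_n -> nat) :
  \sum_(t : torus F n) \prod_i FinRing.uval (t i) ^+ e i =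
  \prod_i \sum_(u : {unit F}) FinRing.uval u ^+ e i.
Proof. by rewrite bigA_distr_bigA. Qed.

(* Coefficients are recovered from values by orthogonality of the characters
   of the torus. *)
Lemma evaluation_eq0 (F : finFieldType) (n : nat) (g : mpoly n F) :
  (forall m : multinom n, m \in msupp g -> forall i, (m i < #|F|.-1)%N) ->
  evaluation g = 0 -> g = 0.
Proof.
move=> box g0; apply/mpolyP => m0; rewrite mcoeff0.
have [m0g|/memN_msupp_eq0//] := boolP (m0 \in msupp g).
pose k := #|F|.-1.
pose e (m : multinom n) i := (m i + (k - m0 i))%N.
(* This is the sum over the torus of [g(t)] times [t] to the power [-m0]; the shift by [k] in [e]
   keeps exponents natural and is harmless since [u ^+ k = 1]. *)
have : \sum_(m <- msupp g)
    mcoeff m g * \prod_i \sum_(u : {unit F}) FinRing.uval u ^+ e m i = 0.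
  transitivity (\sum_(t : torus F n)
      evaluation g t * \prod_i FinRing.uval (t i) ^+ (k - m0 i)); last first.
    by apply: big1 => t _; rewrite g0 ffunE mul0r.
  under eq_bigr do rewrite -sum_torus_monomial mulr_sumr.
  rewrite exchange_big /=; apply: eq_bigr => t _.
  rewrite ffunE mevalE mulr_suml; apply: eq_bigr => m _.
  rewrite -mulrA -big_split /=; congr (_ * _).
  by apply: eq_bigr => i _; rewrite -exprD.
rewrite (bigD1_seq m0) ?msupp_uniq //= [X in _ + X]big1 => [|m mm0].
  rewrite addr0 (eq_bigr (fun=> #|{: {unit F}}|%:R)) => [|i _].
    rewrite prodr_const => /eqP.
    by rewrite mulf_eq0 expf_eq0 (negPf (natr_card_unit F)) andbF orbF => /eqP.
  rewrite (eq_bigr (fun=> 1)) ?sumr_const // => u _.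
  rewrite /e subnKC ?(ltnW (box _ m0g _)) //.
  have uT : u \in [set: {unit F}]%G by rewrite inE.
  have := congr1 val (expg_cardG uT).
  by rewrite FinRing.val_unitX /= card_finField_unit.
have [mg|/memN_msupp_eq0 ->] := boolP (m \in msupp g); last by rewrite mul0r.
have [i mi] : exists i, m i != m0 i.
  apply/existsP; apply: contraR mm0 => /existsPn mm0.
  by apply/eqP/mnmP => i; apply/eqP; rewrite -[_ == _]negbK mm0.
rewrite (bigD1 i) //= sum_unit_expn ?mul0r ?mulr0 //.
have := box _ mg i; have := box _ m0g i; rewrite -/k => m0k mk.
apply/negP => /dvdnP[d]; rewrite /e -/k => de.
(* The exponent lies strictly between 0 and [2 * k], so the only multiple of [k] it can equal is
   [k], which forces [m i = m0 i]. *)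
have d1 : d = 1%N by nia.
by move: mi; rewrite -(eqn_add2r (k - m0 i)) de d1 mul1n subnKC ?eqxx // ltnW.
Qed.

(** * Low-weight codewords from cubes *)

Lemma minimum_distance_le (F : finFieldType) (n : nat) (C : set (word F n)) c :
  C c -> c != 0 -> (minimum_distance C <= hamming_weight c)%N.
Proof.
move=> Cc c0; rewrite /minimum_distance -minEnat -leEnat.
by apply: bigmin_le_cond; rewrite c0 andbT inE.
Qed.

(** Exponents are integers because the edge directions of a cube may have negative entries. *)
Definition character (F : finFieldType) (n : nat) (t : torus F n)
    (v : 'cV[int]_n) : F := \prod_i FinRing.uval (t i) ^ v i 0.

Lemma uval_neq0 (F : finFieldType) (u : {unit F}) : FinRing.uval u != 0.
Proof. by rewrite -unitfE; exact: valP. Qed.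

Lemma character_neq0 (F : finFieldType) (n : nat) (t : torus F n) v :
  character t v != 0.
Proof. by apply/prodf_neq0 => i _; rewrite expfz_neq0 ?uval_neq0. Qed.

Lemma character_unit (F : finFieldType) (n : nat) (t : torus F n) v :
  character t v \is a GRing.unit.
Proof. by rewrite unitfE character_neq0. Qed.

Lemma characterD (F : finFieldType) (n : nat) (t : torus F n) v w :
  character t (v + w) = character t v * character t w.
Proof.
rewrite -big_split; apply: eq_bigr => i _.
by rewrite mxE expfzDr ?uval_neq0.
Qed.

Lemma character0 (F : finFieldType) (n : nat) (t : torus F n) : character t 0 = 1.
Proof. by apply: big1 => i _; rewrite mxE expr0z. Qed.

Definition cube_vertex (n m : nat) (B : 'M[int]_(n, m)) (z : 'cV[int]_n)
    (J : {set 'I_m}) : 'cV[int]_n := z + \sum_(j in J) col j B.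

Lemma int_point_cube_vertex (R : realType) (n m : nat) (B : 'M[int]_(n, m)) z J :
  int_point R (cube_vertex B z J) =
  map_mx intr B *m (\col_j (j \in J)%:R) + int_point R z.
Proof.
rewrite /cube_vertex addrC; apply/matrixP => i l.
rewrite !mxE intrD; congr (_ + _).
rewrite summxE raddf_sum /= big_mkcond /=; apply: eq_bigr => j _.
by rewrite !mxE; case: (j \in J); rewrite ?mulr1 ?mulr0.
Qed.

Lemma cube_vertex_inj (R : realType) (n m : nat) (B : 'M[int]_(n, m)) z :
  injective (fun x : 'cV[R]_m => map_mx intr B *m x) ->
  injective (cube_vertex B z).
Proof.
move=> injB J K /(congr1 (@int_point R n)).
rewrite !int_point_cube_vertex => /addIr /injB /matrixP E.
apply/setP => j; have := E j 0; rewrite !mxE => /eqP.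
by rewrite eqr_nat; case: (j \in J) (j \in K) => [] [].
Qed.

(** Faithful only on nonnegative vectors, such as the vertices of a cube inside the box. *)
Definition multinom_of (n : nat) (v : 'cV[int]_n) : multinom n :=
  Multinom [tuple absz (v i 0) | i < n].

Lemma multinom_ofE (n : nat) (v : 'cV[int]_n) i : multinom_of v i = absz (v i 0).
Proof. by rewrite mnm_tnth tnth_mktuple. Qed.

(** The polynomial [g_a] in expanded form: its factors may be Laurent, but each term sits at a cube
    vertex. *)
Definition cube_poly (F : finFieldType) (n m : nat) (B : 'M[int]_(n, m))
    (z : 'cV[int]_n) (a : 'I_m -> F) : mpoly n F :=
  \sum_(J : {set 'I_m})
    (\prod_(j | j \notin J) - a j) *: mpolyX F (multinom_of (cube_vertex B z J)).

Section CubePoly.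
Variables (R : realType) (F : finFieldType) (n m : nat) (P : set 'cV[R]_n).
Variables (B : 'M[int]_(n, m)) (z : 'cV[int]_n).
Hypothesis Pbox : P `<=` @box R F n.
Hypothesis injB : injective (fun x : 'cV[R]_m => map_mx intr B *m x).
Hypothesis subP :
  [set map_mx intr B *m x + int_point R z | x in @unit_cube R m] `<=` P.
Let v := cube_vertex B z.

Lemma cube_vertex_mem J : P (int_point R (v J)).
Proof.
rewrite int_point_cube_vertex; apply: subP; eexists; last by [].
by move=> j; rewrite mxE; case: (j \in J); rewrite /= ?lexx ?ler01.
Qed.

Lemma cube_vertex_ge0 J i : 0 <= v J i 0.
Proof.
have /Pbox/(_ i)/andP[] := cube_vertex_mem J.
by rewrite mxE ler0z.
Qed.

Lemma absz_cube_vertex J i : (absz (v J i 0))%:Z = v J i 0.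
Proof. by rewrite gez0_abs ?cube_vertex_ge0. Qed.

Lemma multinom_of_cube_vertex_inj : injective (fun J => multinom_of (v J)).
Proof.
move=> J K /= /mnmP JK; apply: (cube_vertex_inj (z := z) injB); apply/matrixP => i j.
rewrite !ord1 -/v -absz_cube_vertex -[RHS]absz_cube_vertex.
by have := JK i; rewrite !multinom_ofE => ->.
Qed.

Lemma msupp_cube_poly (a : 'I_m -> F) w :
  w \in msupp (cube_poly B z a) -> exists J, w = multinom_of (v J).
Proof.
rewrite mcoeff_msupp => w0; apply/not_existsP => wJ.
case/negP: w0; apply/eqP; rewrite /cube_poly raddf_sum big1 //= => J _.
by rewrite mcoeffZ mcoeffX; case: eqP => [/esym/wJ//|]; rewrite mulr0.
Qed.

Lemma cube_poly_monomial_span (a : 'I_m -> F) : monomial_span P (cube_poly B z a).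
Proof.
move=> w /msupp_cube_poly[J ->].
rewrite (_ : \col_i _ = int_point R (v J)); first exact: cube_vertex_mem.
apply/matrixP => i j; rewrite [LHS]mxE [RHS]mxE multinom_ofE ord1.
by rewrite -[in RHS]absz_cube_vertex.
Qed.

(** Distinct [J] give distinct monomials, and the term of the full set has the empty product 1 as
    coefficient. *)
Lemma cube_poly_neq0 (a : 'I_m -> F) : cube_poly B z a != 0.
Proof.
apply/eqP => /(congr1 (mcoeff (multinom_of (v [set: 'I_m]%SET)))).
rewrite mcoeff0 /cube_poly raddf_sum (bigD1 [set: 'I_m]%SET) //= [X in _ + X]big1 => [|J JT].
  rewrite mcoeffZ mcoeffX eqxx mulr1 addr0 big1 => [/eqP|j]; last by rewrite inE.
  by rewrite oner_eq0.
rewrite mcoeffZ mcoeffX -/v (inj_eq multinom_of_cube_vertex_inj).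
by rewrite (negPf JT) mulr0.
Qed.

Lemma evaluation_cube_poly (a : 'I_m -> F) (t : torus F n) :
  evaluation (cube_poly B z a) t =
  character t z * \prod_j (character t (col j B) - a j).
Proof.
rewrite ffunE /cube_poly raddf_sum /= bigA_distr mulr_sumr.
apply: eq_bigr => J _.
rewrite mevalZ mevalX.
rewrite (eq_bigr (fun i => FinRing.uval (t i) ^ v J i 0)) => [|i _]; last first.
  by rewrite multinom_ofE -[in RHS]absz_cube_vertex.
rewrite -/(character t (v J)) characterD mulrCA; congr (_ * _).
rewrite (big_morph _ (characterD t) (character0 t)) mulrC.
rewrite [RHS](bigID (mem J)) /=; congr (_ * _); apply: eq_bigr => j.
  by move->.
by move/negPf->.
Qed.

Lemma evaluation_cube_poly_neq0 (a : 'I_m -> F) : evaluation (cube_poly B z a) != 0.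
Proof.
apply: contra (cube_poly_neq0 a) => /eqP ev0; apply/eqP.
apply: evaluation_eq0 ev0 => w /msupp_cube_poly[J ->] i.
have /Pbox/(_ i)/andP[_] := cube_vertex_mem J.
rewrite mxE -/v -absz_cube_vertex multinom_ofE lerBrDr.
rewrite -pmulrn -natrD ler_nat.
by rewrite addn2; case: #|F|.
Qed.

(* For each t exactly (q-2)^m of the (q-1)^m choices of a give a polynomial not
   vanishing at t. *)
Lemma sum_hamming_weight_cube_poly :
  (\sum_(a : {ffun 'I_m -> {unit F}})
     hamming_weight (evaluation (cube_poly B z (fun j => FinRing.uval (a j))))
   <= #|F|.-1 ^ n * #|F|.-2 ^ m)%N.
Proof.
(* The unique value of [a j] for which the [j]-th factor vanishes at [t]. *)
pose phi (t : torus F n) j : {unit F} :=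
  FinRing.unit F (character_unit t (col j B)).
have -> : (#|F|.-1 ^ n * #|F|.-2 ^ m = \sum_(t : torus F n)
    \sum_(a : {ffun 'I_m -> {unit F}}) \prod_j (a j != phi t j))%N.
  rewrite -card_torus -sum_nat_const; apply: eq_bigr => t _.
  rewrite -(bigA_distr_bigA (fun j u => nat_of_bool (u != phi t j))).
  rewrite (eq_bigr (fun=> #|F|.-2)) ?prod_nat_const ?card_ord // => j _.
  by rewrite -card_unit -(cardC1 (phi t j)) card_sum_mem.
rewrite exchange_big /=; apply: leq_sum => a _.
rewrite /hamming_weight -sum1_card big_mkcond /=; apply: leq_sum => t _.
rewrite inE evaluation_cube_poly mulf_eq0 negb_or character_neq0 /=.
case: ifP => // /prodf_neq0 ne.
rewrite big1 // => j _; case: eqP => // aj.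
by have := ne j isT; rewrite aj subrr eqxx.
Qed.

End CubePoly.

(** Averaging: each of the [#|F|.-1 ^ m] choices of [a] gives a nonzero codeword, and their total
    weight is bounded. *)
Lemma cube_minimum_distance (R : realType) (F : finFieldType) (n m : nat)
    (P : set 'cV[R]_n) :
  P `<=` @box R F n -> contains_cube P m ->
  (minimum_distance (@toric_code R F n P) * #|F|.-1 ^ m <= #|F|.-1 ^ n * #|F|.-2 ^ m)%N.
Proof.
move=> Pbox [B [z [injB subP]]].
apply: leq_trans (sum_hamming_weight_cube_poly Pbox subP).
rewrite -card_unit -[X in (_ ^ X)%N]card_ord -card_ffun mulnC -sum_nat_const.
apply: leq_sum => a _; apply: minimum_distance_le.
  exists (cube_poly B z (fun j => FinRing.uval (a j))) => //.
  exact: (cube_poly_monomial_span Pbox subP).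
exact: (evaluation_cube_poly_neq0 Pbox injB subP).
Qed.

(** * Limits of rates and distances *)

Lemma card_lattice_points_box (R : realType) (F : finFieldType) (n : nat)
    (P : set 'cV[R]_n) : P `<=` @box R F n ->
  #|` fset_set (lattice_points P)| = #|grid_points #|F|.-1 P|.
Proof.
move=> Pbox; set A := grid_points _ P.
(* Exhibiting a finite set here makes [fset_set] faithful. *)
have -> : lattice_points P = [set` [fset grid_point a | a in A]%fset].
  apply/seteqP; split=> z.
    rewrite /lattice_points /= => Pz.
    have z01 i : z i 0 = (absz (z i 0))%:Z /\ (absz (z i 0%R) < #|F|.-1)%N.
      have /andP[] := Pbox _ Pz i; rewrite mxE ler0z => z0.
      rewrite -[z i 0]gez0_abs // -pmulrn lerBrDr -natrD ler_nat addn2.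
      by case: #|F|.
    apply/imfsetP; exists (\col_i Ordinal (z01 i).2) => /=; last first.
      by apply/matrixP => i j; rewrite !mxE ord1; exact: (z01 i).1.
    rewrite inE; apply/asboolP.
    rewrite (_ : grid_point _ = z) //.
    by apply/matrixP => i j; rewrite !mxE ord1; exact/esym/(z01 i).1.
  by move=> /imfsetP[a /=]; rewrite inE => /asboolP Pa ->.
rewrite set_fsetK card_imfset; last exact: grid_point_inj.
by rewrite /= -cardE.
Qed.

Lemma natr_pred_card (R : realType) (F : finFieldType) :
  #|F|%:R - 1 = #|F|.-1%:R :> R.
Proof.
by rewrite -subn1 natrB //; apply/card_gt0P; exists 0.
Qed.

Lemma relative_distance_le (R : realType) (F : finFieldType) (n m : nat)
    (P : set 'cV[R]_n) : (1 < #|F|)%N ->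
  P `<=` @box R F n -> contains_cube P m ->
  relative_distance F P <= (#|F|.-2%:R / #|F|.-1%:R) ^+ m.
Proof.
move=> q1 Pbox Pm.
have k0 : 0 < #|F|.-1%:R :> R by rewrite ltr0n -subn1 subn_gt0.
rewrite /relative_distance natr_pred_card ler_pdivrMr ?exprn_gt0 //.
rewrite exprMn mulrAC exprVn ler_pdivlMr ?exprn_gt0 // -!natrX -!natrM ler_nat.
by rewrite [leqRHS]mulnC; exact: cube_minimum_distance.
Qed.

Lemma information_rate_cvg0 (R : realType) (F : finFieldType) (n : nat -> nat)
    (P : forall i, set 'cV[R]_(n i)) (K : nat) : (2 < #|F|)%N ->
  (forall i, [/\ integral_polytope (P i), P i !=set0 & P i `<=` @box R F (n i)]) ->
  n @ \oo --> \oo -> (forall i, (max_cube (P i) <= K)%N) ->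
  information_rate F (P i) @[i --> \oo] --> (0 : R).
Proof.
move=> q2 polyP /cvgnyPge noo PK; apply/cvgrPdist_le => e e0.
have k1 : (1 < #|F|.-1)%N by rewrite -subn1 ltn_subRL.
have k0 : 0 < #|F|.-1%:R :> R by rewrite ltr0n ltnW.
(* The density constant is an integer above [e^-1], so the rate falls below [e]. *)
have [N sparse] := sparse_grid_points R K.+1 (Num.truncn e^-1).+1 k1.
apply: filterS (noo N) => i Ni.
have [intP P0 Pbox] := polyP i.
have := sparse _ (P i) Ni (convex_integral_polytope intP).
have noc : ~ contains_cube (P i) K.+1.
  by move=> /(proj2 (max_cubeP P0 intP)); rewrite leqNgt ltnS PK.
move=> /(_ noc); rewrite -(card_lattice_points_box Pbox) => bound.
rewrite sub0r normrN ger0_norm ?divr_ge0 ?exprn_ge0 ?natr_pred_card ?ler0n //.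
rewrite /information_rate natr_pred_card ler_pdivrMr ?exprn_gt0 //.
move: bound; rewrite -(ler_nat R) natrM natrX => bound.
rewrite -ler_pdivrMl //; apply: le_trans bound.
by rewrite ler_wpM2r // ltW // truncnS_gt.
Qed.

Lemma max_cube_bounded (R : realType) (F : finFieldType) (n : nat -> nat)
    (P : forall i, set 'cV[R]_(n i)) : (2 < #|F|)%N ->
  (forall i, [/\ integral_polytope (P i), P i !=set0 & P i `<=` @box R F (n i)]) ->
  cvgn (fun i => relative_distance F (P i)) ->
  0 < limn (fun i => relative_distance F (P i)) ->
  exists K, forall i, (max_cube (P i) <= K)%N.
Proof.
move=> q2 polyP cvd; set d := limn _ => d0.
have q1 : (1 < #|F|)%N by exact: ltnW.
set r : R := #|F|.-2%:R / #|F|.-1%:R.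
have k0 : 0 < #|F|.-1%:R :> R by rewrite ltr0n -subn1 subn_gt0.
have r0 : 0 <= r by rewrite divr_ge0.
have r1 : r < 1.
  by rewrite ltr_pdivrMr // mul1r ltr_nat prednK // -subn1 subn_gt0.
have d2 : d / 2 < d by lra.
have d20 : 0 < d / 2 by lra.
have [i0 _ di0] := cvgr_gt d cvd _ d2.
have r01 : `|r| < 1 by rewrite ger0_norm.
have [M _ rM] := cvgr_lt 0 (cvg_expr r01) _ d20.
(* From [i0] on the distance exceeds [d / 2], while [r ^+ m < d / 2] for [m >= M]; the finitely many
   earlier indices enter through their maximum. *)
exists (maxn M (\max_(i < i0) max_cube (P i))) => i.
have [ii0|i0i] := ltnP i i0.
  by rewrite leq_max; apply/orP; right; exact: (leq_bigmax (Ordinal ii0)).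
rewrite leq_max leqNgt; apply/orP; left; apply/negP => Mi.
have [intP P0 Pbox] := polyP i.
have := relative_distance_le q1 Pbox (proj1 (max_cubeP P0 intP)).
apply/negP; rewrite -ltNge; apply: lt_trans (di0 i i0i).
exact: rM (ltnW Mi).
Qed.

(** For [#|F| = 2] the box is a single point and every rate is 1, which is why [q_gt2] is
    assumed. *)
Theorem theorem1p5 (R : realType) (F : finFieldType) (q_gt2 : (2 < #|F|)%N) :
  (forall (n : nat -> nat) (P : forall i, set 'cV[R]_(n i)),
     infinite_toric_family F P ->
     (exists K : nat, forall i, (max_cube (P i) <= K)%N) ->
     information_rate F (P i) @[i --> \oo] --> (0 : R)) /\
  ~ (exists (n : nat -> nat) (P : forall i, set 'cV[R]_(n i)),
       [/\ infinite_toric_family F P,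
           0 < limn (fun i => relative_distance F (P i)) &
           0 < limn (fun i => information_rate F (P i))]).
Proof.
split=> [n P [polyP noo _ _] [K PK]|[n [P [[polyP noo cvd _] d0 R0]]]].
  exact: information_rate_cvg0 PK.
have [K PK] := max_cube_bounded q_gt2 polyP cvd d0.
have /cvg_lim R0' := information_rate_cvg0 q_gt2 polyP noo PK.
by move: R0; rewrite R0' ?ltxx.
Qed.
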